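(* For every quantale $\mathcal{V}$, the $\mathcal{V}$-normed category $\mathbf{Set}|\!|\mathcal{V}$ of $\mathcal{V}$-normed sets and arbitrary maps is Cauchy cocomplete.
   Context: Quantale: a complete lattice $\mathcal{V}$ with a commutative monoid structure $(\otimes,\mathrm{k})$ such that $\otimes$ preserves arbitrary joins in each variable; $[u,-]$ denotes the right adjoint of $-\otimes u$, i.e. $w\otimes u\le v\iff w\le[u,v]$. A $\mathcal{V}$-normed set is a set $A$ with a function $|{-}|:A\to\mathcal{V}$. A $\mathcal{V}$-normed category is an ordinary category with a norm $|f|\in\mathcal{V}$ for every morphism such that $\mathrm{k}\le|1_a|$ and $|g|\otimes|f|\le|g\cdot f|$. $\mathbf{Set}|\!|\mathcal{V}$ has as objects all $\mathcal{V}$-normed sets and as morphisms $A\to B$ all maps $\varphi:A\to B$, normed by $|\varphi|=\bigwedge_{a\in A}[|a|,|\varphi a|]$. $\mathbf{Set}/\!\!/\mathcal{V}$ denotes the ordinary category of $\mathcal{V}$-normed sets and $\mathcal{V}$-normed maps, i.e. maps $f:A\to B$ with $|a|\le|fa|$ for all $a\in A$. A sequence in a $\mathcal{V}$-normed category $\mathbb{X}$ is a functor $s=(x_m\xrightarrow{s_{m,n}}x_n)_{m\le n\in\mathbb{N}}$ from the ordered set $\mathbb{N}$ to $\mathbb{X}$ (no norm condition on the $s_{m,n}$). It is Cauchy if $\mathrm{k}\le\bigvee_{N\in\mathbb{N}}\bigwedge_{N\le m\le n}|s_{m,n}|$. An object $x$ with a cocone $\gamma=(\gamma_n:x_n\to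 x)_{n}$ is a normed colimit of $s$ if (C1) $\gamma$ is a colimit cocone in the ordinary category $\mathbb{X}$, and (C2) for all objects $y$, the canonical bijections $\kappa_N:\mathrm{Nat}(s_{|N},\Delta y)\to\mathbb{X}(x,y)$, $(f\cdot\gamma_n)_{n\ge N}\mapsto f$ ($N\in\mathbb{N}$), form a colimit cocone in $\mathbf{Set}/\!\!/\mathcal{V}$, where $s_{|N}$ is the restriction of $s$ to $\{N,N+1,\dots\}$, $\mathrm{Nat}(s_{|N},\Delta y)$ is normed by $|(\sigma_n)_{n\ge N}|=\bigwedge_{n\ge N}|\sigma_n|$, and the connecting maps are restrictions. Given (C1), condition (C2) is equivalent to: (C2a) $\mathrm{k}\le\bigvee_{N}\bigwedge_{n\ge N}|\gamma_n|$ and (C2b) $|f|\ge\bigvee_N\bigwedge_{n\ge N}|f\cdot\gamma_n|$ for every morphism $f:x\to y$ in $\mathbb{X}$. $\mathbb{X}$ is Cauchy cocomplete if every Cauchy sequence in $\mathbb{X}$ has a normed colimit in $\mathbb{X}$. *)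

(* Defs.v *)
From HB Require Import structures.
From mathcomp Require Import all_boot all_order.
From mathcomp Require Import boolp classical_sets.

Set Implicit Arguments.
Unset Strict Implicit.
Unset Printing Implicit Defensive.

Import Order.TTheory.
Local Open Scope classical_set_scope.
Local Open Scope order_scope.

(* A complete lattice is given as a poset with all suprema.  Since the monoid
   is commutative, preservation of joins in one variable is preservation in
   each. *)
HB.mixin Record isQuantale d V of Order.POrder d V := {
  qsup : set V -> V;
  qsupP : forall A : set V, supremums A (qsup A);
  qmul : V -> V -> V;
  qunit : V;
  qmulA : associative qmul;
  qmulC : commutative qmul;
  qmul1l : left_id qunit qmul;
  qmul_sup : forall (u : V) (A : set V),
    qmul u (qsup A) = qsup [set qmul u a | a in A]
}.

#[short(type="quantaleType")]
HB.structure Definition Quantale d := {V of isQuantale d V & Order.POrder d V}.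

Section QuantaleTheory.
Context {d : Order.disp_t} {V : quantaleType d}.
Implicit Types (u v w : V) (A : set V).

Definition qinf A : V := qsup (lbound A).

Definition qhom u v : V := qsup [set w | qmul w u <= v].

Lemma qsup_ub A v : A v -> v <= qsup A.
Proof. by case: (qsupP A) => ub _; exact: ub. Qed.

Lemma qsup_le A v : (forall a, A a -> a <= v) -> qsup A <= v.
Proof. by case: (qsupP A) => _ lub; exact: lub. Qed.

Lemma qinf_lb A v : A v -> qinf A <= v.
Proof. by move=> Av; apply: qsup_le => w; apply. Qed.

Lemma qinf_ge A v : (forall a, A a -> v <= a) -> v <= qinf A.
Proof. exact: qsup_ub. Qed.

Lemma qmul_monor u v w : v <= w -> qmul u v <= qmul u w.
Proof.
move=> vw; have -> : w = qsup [set x | x <= w].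
  apply/le_anti/andP; split; first exact: qsup_ub (lexx w).
  by apply: qsup_le.
by rewrite qmul_sup; apply: qsup_ub; exists v.
Qed.

Lemma qmul_mono u u' v v' : u <= u' -> v <= v' -> qmul u v <= qmul u' v'.
Proof.
move=> uu vv; apply: le_trans (qmul_monor u vv) _.
by rewrite qmulC (qmulC u'); apply: qmul_monor.
Qed.

Lemma qhom_adj u v w : (qmul w u <= v) = (w <= qhom u v).
Proof.
apply/idP/idP => [|wuv]; first exact: qsup_ub.
apply: le_trans (qmul_mono wuv (lexx u)) _.
rewrite qmulC qmul_sup; apply: qsup_le => _ [x xuv <-].
by rewrite qmulC.
Qed.

End QuantaleTheory.

Record category := Category {
  obj :> Type;
  hom : obj -> obj -> Type;
  idm : forall x, hom x x;
  compm : forall x y z, hom y z -> hom x y -> hom x z;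
  compm1 : forall x y (f : hom x y), compm f (idm x) = f;
  comp1m : forall x y (f : hom x y), compm (idm y) f = f;
  compmA : forall x y z t (h : hom z t) (g : hom y z) (f : hom x y),
    compm h (compm g f) = compm (compm h g) f
}.
Arguments hom {c} x y.
Arguments idm {c} x.
Arguments compm {c x y z} g f.

Record sequence (C : category) := Sequence {
  sob :> nat -> C;
  smap : forall m n, (m <= n)%N -> hom (sob m) (sob n);
  smap_id : forall n (h : (n <= n)%N), smap h = idm (sob n);
  smap_comp : forall m n p (mn : (m <= n)%N) (np : (n <= p)%N) (mp : (m <= p)%N),
    smap mp = compm (smap np) (smap mn)
}.
Arguments smap {C} s {m n} h.

Record cocone (C : category) (s : sequence C) (y : C) := Cocone {
  leg :> forall n, hom (s n) y;
  leg_nat : forall m n (mn : (m <= n)%N), compm (leg n) (smap s mn) = leg m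
}.

Definition is_colimit (C : category) (s : sequence C) (x : C)
    (gamma : cocone s x) : Prop :=
  forall (y : C) (sigma : cocone s y),
    exists! f : hom x y, forall n, compm f (gamma n) = sigma n.

(* Natural transformations from s restricted to {N, N+1, ...} to the constant
   diagram at y. *)
Record tail_cocone (C : category) (s : sequence C) (N : nat) (y : C) :=
  TailCocone {
    tleg :> forall n, (N <= n)%N -> hom (s n) y;
    tleg_nat : forall m n (Nm : (N <= m)%N) (Nn : (N <= n)%N) (mn : (m <= n)%N),
      compm (tleg Nn) (smap s mn) = tleg Nm
  }.

Section TailCocone.
Context {C : category} {s : sequence C}.

Lemma tail_cocone_eq N (y : C) (sigma tau : tail_cocone s N y) :
  (forall n (Nn : (N <= n)%N), sigma n Nn = tau n Nn) -> sigma = tau.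
Proof.
case: sigma tau => [f fP] [g gP] /= fg.
have E : f = g by apply: functional_extensionality_dep => n; apply/funext => Nn.
by case: g / E gP {fg} => gP; congr TailCocone; exact: Prop_irrelevance.
Qed.

Definition tail_restrict (y : C) M N (MN : (M <= N)%N)
    (sigma : tail_cocone s M y) : tail_cocone s N y :=
  @TailCocone C s N y (fun n Nn => sigma n (leq_trans MN Nn))
    (fun m n Nm Nn mn => tleg_nat sigma _ _ mn).

Lemma tail_compP (x y : C) (gamma : cocone s x) (f : hom x y) m n
    (mn : (m <= n)%N) :
  compm (compm f (gamma n)) (smap s mn) = compm f (gamma m).
Proof. by rewrite -compmA leg_nat. Qed.

Definition tail_comp (x y : C) (gamma : cocone s x) (N : nat) (f : hom x y) :
    tail_cocone s N y :=
  @TailCocone C s N y (fun n _ => compm f (gamma n))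
    (fun m n _ _ mn => tail_compP gamma f mn).

End TailCocone.

Section Normed.
Context {d : Order.disp_t} (V : quantaleType d).

Record normed_set := NormedSet {
  carrier :> Type;
  snorm : carrier -> V
}.

Record normed_category := NormedCategory {
  ncat :> category;
  mnorm : forall x y : ncat, hom x y -> V;
  mnorm_id : forall x : ncat, qunit <= mnorm (idm x);
  mnorm_comp : forall (x y z : ncat) (g : hom y z) (f : hom x y),
    qmul (mnorm g) (mnorm f) <= mnorm (compm g f)
}.

(* Set//V *)
Record normed_map (A B : normed_set) := NormedMap {
  nmap :> A -> B;
  nmapP : forall a, snorm a <= snorm (nmap a)
}.

Lemma normed_map_eq (A B : normed_set) (f g : normed_map A B) :
  (forall a, f a = g a) -> f = g.
Proof.
case: f g => [f fP] [g gP] /= fg.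
have E : f = g by apply/funext.
by case: g / E gP {fg} => gP; congr NormedMap; exact: Prop_irrelevance.
Qed.

Definition normed_map_id (A : normed_set) : normed_map A A :=
  @NormedMap A A (fun a => a) (fun a => lexx (snorm a)).

Definition normed_map_comp (A B D : normed_set) (g : normed_map B D)
    (f : normed_map A B) : normed_map A D :=
  @NormedMap A D (fun a => g (f a))
    (fun a => le_trans (nmapP f a) (nmapP g (f a))).

Lemma normed_map_compm1 (A B : normed_set) (f : normed_map A B) :
  normed_map_comp f (normed_map_id A) = f.
Proof. exact: normed_map_eq. Qed.

Lemma normed_map_comp1m (A B : normed_set) (f : normed_map A B) :
  normed_map_comp (normed_map_id B) f = f.
Proof. exact: normed_map_eq. Qed.

Lemma normed_map_compA (A B D E : normed_set) (h : normed_map D E)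
    (g : normed_map B D) (f : normed_map A B) :
  normed_map_comp h (normed_map_comp g f) =
  normed_map_comp (normed_map_comp h g) f.
Proof. exact: normed_map_eq. Qed.

Definition SetNormedMaps : category :=
  Category normed_map_compm1 normed_map_comp1m normed_map_compA.

(* Set||V *)
Definition map_norm (A B : normed_set) (phi : A -> B) : V :=
  qinf (range (fun a : A => qhom (snorm a) (snorm (phi a)))).

Lemma map_norm_id (A : normed_set) : qunit <= map_norm (fun a : A => a).
Proof. by apply: qinf_ge => _ [a _ <-]; rewrite -qhom_adj qmul1l. Qed.

Lemma map_norm_comp (A B D : normed_set) (g : B -> D) (f : A -> B) :
  qmul (map_norm g) (map_norm f) <= map_norm (fun a => g (f a)).
Proof.
apply: qinf_ge => _ [a _ <-]; rewrite -qhom_adj -qmulA.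
have fa : qmul (map_norm f) (snorm a) <= snorm (f a).
  by rewrite qhom_adj; apply: qinf_lb; exists a.
apply: le_trans (qmul_monor _ fa) _.
by rewrite qhom_adj; apply: qinf_lb; exists (f a).
Qed.

Definition SetMaps : category :=
  @Category normed_set (fun A B => A -> B) (fun A a => a)
    (fun A B D g f a => g (f a)) (fun A B f => erefl f) (fun A B f => erefl f)
    (fun A B D E h g f => erefl (fun a => h (g (f a)))).

Definition NormedSets : normed_category :=
  @NormedCategory SetMaps map_norm map_norm_id map_norm_comp.

Section NormedColimit.
Variable X : normed_category.

Definition is_cauchy (s : sequence X) : Prop :=
  qunit <= qsup (range (fun N : nat =>
    qinf [set v : V | exists (m n : nat) (mn : (m <= n)%N),
                        (N <= m)%N /\ v = mnorm (smap s mn)])).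

Definition hom_set (x y : X) : SetNormedMaps :=
  @NormedSet (hom x y) (@mnorm X x y).

Section Tail.
Variables (s : sequence X) (y : X).

Definition tail_norm N (sigma : tail_cocone s N y) : V :=
  qinf [set v : V | exists (n : nat) (Nn : (N <= n)%N), v = mnorm (sigma n Nn)].

Definition tail_set (N : nat) : SetNormedMaps :=
  @NormedSet (tail_cocone s N y) (@tail_norm N).

Lemma tail_restrict_norm M N (MN : (M <= N)%N) (sigma : tail_cocone s M y) :
  tail_norm sigma <= tail_norm (tail_restrict MN sigma).
Proof.
by apply: qinf_ge => _ [n [Nn ->]]; apply: qinf_lb; exists n, (leq_trans MN Nn).
Qed.

Definition tail_map M N (MN : (M <= N)%N) : hom (tail_set M) (tail_set N) :=
  @NormedMap (tail_set M) (tail_set N) (tail_restrict MN)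
    (tail_restrict_norm MN).

Lemma tail_map_id N (NN : (N <= N)%N) : tail_map NN = idm (tail_set N).
Proof.
apply: normed_map_eq => sigma; apply: tail_cocone_eq => n Nn /=.
by rewrite (bool_irrelevance (leq_trans NN Nn) Nn).
Qed.

Lemma tail_map_comp M N P (MN : (M <= N)%N) (NP : (N <= P)%N)
    (MP : (M <= P)%N) :
  tail_map MP = compm (tail_map NP) (tail_map MN).
Proof.
apply: normed_map_eq => sigma; apply: tail_cocone_eq => n Pn /=.
by congr (sigma n _); exact: bool_irrelevance.
Qed.

Definition tail_sequence : sequence SetNormedMaps :=
  @Sequence SetNormedMaps tail_set tail_map tail_map_id tail_map_comp.

End Tail.

(* When gamma is a colimit cocone, f |-> (f . gamma_n)_(n >= N) is a bijection
   from hom x y onto tail_cocone s N y, so the equation below determines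
   kappa. *)
Definition is_normed_colimit (s : sequence X) (x : X) (gamma : cocone s x) :
    Prop :=
  is_colimit gamma /\
  forall y : X, exists kappa : cocone (tail_sequence s y) (hom_set x y),
    (forall (N : nat) (f : hom x y),
       (kappa N : normed_map _ _) (tail_comp gamma N f) = f) /\
    is_colimit kappa.

Definition cauchy_cocomplete : Prop :=
  forall s : sequence X, is_cauchy s ->
    exists (x : X) (gamma : cocone s x), is_normed_colimit gamma.

End NormedColimit.

End Normed.

(* Main.v *)
Require Import Defs.
From mathcomp Require Import all_boot all_order.
From mathcomp Require Import boolp classical_sets.

(**
  The underlying set of the colimit of a sequence of normed sets [s n] is the
  set of germs [g_n a] of elements [a] of [s n].  It is normed by
    [|x| = sup_N inf_(n >= N) sup_(g_n a = x) |a|].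
  If [c <= |s_(m,n)|] for all [N <= m <= n], then [c * |a| <= |s_(m,n) a|] for
  all [n >= m], hence [c * |a| <= |g_m a|]: this turns the Cauchy condition into
  (C2a).  If [w <= |f g_n|] for all [n >= N], then [w * |x|] is bounded by the
  supremum of the [w * |a|] with [g_n a = x] for large [n], hence by [|f x|]:
  this is (C2b).
*)

Set Implicit Arguments.
Unset Strict Implicit.
Unset Printing Implicit Defensive.

Import Order.TTheory.
Local Open Scope classical_set_scope.
Local Open Scope order_scope.

(** * Tail cocones against full cocones *)

Section TailExtension.
Context {C : category} {s : sequence C}.

Lemma tail_extend_nat N (y : C) (sigma : tail_cocone s N y) m n
    (mn : (m <= n)%N) :
  compm (compm (sigma (maxn N n) (leq_maxl N n)) (smap s (leq_maxr N n)))
    (smap s mn) =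
  compm (sigma (maxn N m) (leq_maxl N m)) (smap s (leq_maxr N m)).
Proof.
have mnN : (maxn N m <= maxn N n)%N by rewrite geq_max leq_maxl leq_max mn orbT.
rewrite -(tleg_nat sigma (leq_maxl N m) (leq_maxl N n) mnN) -!compmA.
have mN := leq_trans mn (leq_maxr N n).
by rewrite -(smap_comp s mn _ mN) -(smap_comp s (leq_maxr N m) mnN mN).
Qed.

(** The leg at [n] goes through stage [maxn N n], which also supplies legs below [N]; from [N] on it
    agrees with [sigma]. *)
Definition tail_extend N (y : C) (sigma : tail_cocone s N y) : cocone s y :=
  Cocone (tail_extend_nat sigma).

Lemma colimit_tail (x : C) (gamma : cocone s x) N (y : C)
    (sigma : tail_cocone s N y) :
  is_colimit gamma -> exists f : hom x y, tail_comp gamma N f = sigma.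
Proof.
move=> colim; have [f [fP _]] := colim y (tail_extend sigma).
exists f; apply: tail_cocone_eq => n Nn /=; rewrite fP /=.
by rewrite (tleg_nat sigma Nn).
Qed.

(** A full cocone is determined by its legs from [N] on, so [f] and [g] both factor the same
    extended cocone. *)
Lemma colimit_tail_inj (x : C) (gamma : cocone s x) N (y : C) (f g : hom x y) :
  is_colimit gamma -> tail_comp gamma N f = tail_comp gamma N g -> f = g.
Proof.
move=> colim fg.
pose sigma := tail_extend (tail_comp gamma N f).
have [h [_ hU]] := colim y sigma.
have hE k : tail_comp gamma N k = tail_comp gamma N f -> h = k.
  by move=> kf; apply: hU => n; rewrite /sigma -kf /= -compmA leg_nat.
by rewrite -(hE f) // -(hE g).
Qed.

End TailExtension.

(** * Sufficiency of (C1), (C2a) and (C2b) for a normed colimit *)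

Section NormedColimitCriterion.
Context {d : Order.disp_t} {V : quantaleType d} {X : normed_category V}.
Variables (s : sequence X) (x : X) (gamma : cocone s x).

Definition cocone_norm N : V :=
  qinf [set v : V | exists2 n, (N <= n)%N & v = mnorm (gamma n)].

Lemma tail_norm_comp (y : X) (f : hom x y) N :
  qmul (mnorm f) (cocone_norm N) <= tail_norm (tail_comp gamma N f).
Proof.
apply: qinf_ge => _ [n [Nn ->]].
apply: le_trans (mnorm_comp f (gamma n)); apply: qmul_monor.
by apply: qinf_lb; exists n.
Qed.

Hypothesis colim : is_colimit gamma.
Hypothesis C2a : qunit <= qsup (range cocone_norm).
Hypothesis C2b : forall (y : X) (f : hom x y) N,
  tail_norm (tail_comp gamma N f) <= mnorm f.

Definition tail_factor (y : X) N (sigma : tail_cocone s N y) : hom x y :=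
  projT1 (cid (colimit_tail sigma colim)).

Lemma tail_factorK (y : X) N (sigma : tail_cocone s N y) :
  tail_comp gamma N (tail_factor sigma) = sigma.
Proof. exact: projT2 (cid (colimit_tail sigma colim)). Qed.

Lemma tail_compK (y : X) N (f : hom x y) :
  tail_factor (tail_comp gamma N f) = f.
Proof. by apply: (colimit_tail_inj colim); exact: tail_factorK. Qed.

Lemma tail_factor_norm (y : X) N (sigma : tail_set s y N) :
  snorm sigma <= snorm (tail_factor sigma : hom_set x y).
Proof. by rewrite /= -{1}(tail_factorK sigma); exact: C2b. Qed.

Lemma tail_restrict_comp (y : X) M N (MN : (M <= N)%N) (f : hom x y) :
  tail_restrict MN (tail_comp gamma M f) = tail_comp gamma N f.
Proof. exact: tail_cocone_eq. Qed.

Definition tail_factor_map (y : X) N :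
    hom (tail_sequence s y N) (hom_set x y) :=
  @NormedMap _ V (tail_set s y N) (hom_set x y) (@tail_factor y N)
    (@tail_factor_norm y N).

Lemma tail_factor_nat (y : X) M N (MN : (M <= N)%N) :
  compm (tail_factor_map y N) (smap (tail_sequence s y) MN) =
  tail_factor_map y M.
Proof.
apply: normed_map_eq => sigma /=.
by rewrite -{1}(tail_factorK sigma) tail_restrict_comp tail_compK.
Qed.

Definition tail_factor_cocone (y : X) :
    cocone (tail_sequence s y) (hom_set x y) :=
  Cocone (@tail_factor_nat y).

(** Since [tail_comp gamma 0] inverts the component at 0, the mediating map can only be [tau 0]
    after it. *)
Lemma tail_factor_colimit (y : X) : is_colimit (tail_factor_cocone y).
Proof.
move=> Z tau.
pose t N : tail_cocone s N y -> (Z : normed_set V) :=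
  (tau N : normed_map (tail_set s y N) Z).
have tE N f : t N (tail_comp gamma N f) = t 0%N (tail_comp gamma 0%N f).
  rewrite -(tail_restrict_comp (leq0n N)).
  exact: (congr1 (fun h : normed_map (tail_set s y 0) Z =>
    h (tail_comp gamma 0%N f)) (leg_nat tau (leq0n N))).
have h_norm (f : hom_set x y) : snorm f <= snorm (t 0%N (tail_comp gamma 0%N f)).
  (* (C2a) bounds [mnorm f] by the join of the [qmul (mnorm f) (cocone_norm N)]. Each term is
     estimated through [tau N], which [tE] allows in place of [tau 0]. *)
  rewrite /= -[mnorm f]qmul1l qmulC.
  apply: le_trans (qmul_monor _ C2a) _.
  rewrite qmul_sup; apply: qsup_le => _ [_ [N _ <-] <-].
  apply: le_trans (tail_norm_comp f N) _; rewrite -(tE N).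
  exact: (nmapP (tau N : normed_map (tail_set s y N) Z)).
exists (@NormedMap _ V (hom_set x y) Z _ h_norm); split.
  move=> N; apply: normed_map_eq => sigma /=.
  by rewrite -(tE N) tail_factorK.
move=> h hP; apply: normed_map_eq => f /=.
have := congr1 (fun h : normed_map (tail_set s y 0) Z =>
  h (tail_comp gamma 0%N f)) (hP 0%N).
by rewrite /= tail_compK.
Qed.

Lemma normed_colimit_criterion : is_normed_colimit gamma.
Proof.
split=> // y; exists (tail_factor_cocone y); split.
  by move=> N f; exact: tail_compK.
exact: tail_factor_colimit.
Qed.

End NormedColimitCriterion.

(** * The colimit of sets, realised by germs *)

Section Germs.
Context {d : Order.disp_t} {V : quantaleType d}.
Variable s : sequence (SetMaps V).

Definition elt n : Type := carrier (s n : normed_set V).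

Definition step m n (mn : (m <= n)%N) : elt m -> elt n := smap s mn.

Lemma step_comp m n p (mn : (m <= n)%N) (np : (n <= p)%N) (mp : (m <= p)%N)
    (a : elt m) : step np (step mn a) = step mp a.
Proof. by rewrite /step (smap_comp s mn np mp). Qed.

(** The equivalence class of [a] under eventual agreement, as a subset of the disjoint union of the
    stages. *)
Definition germ_set n (a : elt n) : set {m & elt m} :=
  [set u | exists p (np : (n <= p)%N) (mp : (tag u <= p)%N),
             step np a = step mp (tagged u)].

Lemma germ_set_refl n (a : elt n) : germ_set a (Tagged elt a).
Proof. by exists n, (leqnn n), (leqnn n). Qed.

(** Agreement at stages [p] and [q] persists at [maxn p q], which gives transitivity. *)
Lemma germ_set_eq m (a : elt m) n (b : elt n) p (mp : (m <= p)%N)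
    (np : (n <= p)%N) : step mp a = step np b -> germ_set a = germ_set b.
Proof.
have sub m' (a' : elt m') n' (b' : elt n') (mp' : (m' <= p)%N)
    (np' : (n' <= p)%N) : step mp' a' = step np' b' ->
    germ_set a' `<=` germ_set b'.
  move=> ab [l e] /= [q [mq [lq ae]]].
  have pr := leq_maxl p q; have qr := leq_maxr p q.
  exists (maxn p q), (leq_trans np' pr), (leq_trans lq qr) => /=.
  rewrite -(step_comp np' pr) -ab -(step_comp lq qr) -ae.
  rewrite (step_comp _ _ (leq_trans mp' pr)).
  by rewrite (step_comp _ _ (leq_trans mp' pr)).
by move=> ab; apply/seteqP; split; [exact: sub ab|apply: sub; exact: esym ab].
Qed.

Definition germs : Type :=
  {S : set {m & elt m} | exists n (a : elt n), S = germ_set a}.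

Definition germ n (a : elt n) : germs :=
  exist _ (germ_set a) (ex_intro _ n (ex_intro _ a erefl)).

Lemma germP (x : germs) : exists u : {n & elt n}, germ (tagged u) = x.
Proof.
case: x => S [n [a SE]]; exists (Tagged elt a); apply: eq_exist => /=.
by rewrite SE.
Qed.

Lemma germ_eq m (a : elt m) n (b : elt n) :
  germ a = germ b <->
  exists p (mp : (m <= p)%N) (np : (n <= p)%N), step mp a = step np b.
Proof.
split=> [[ab]|[p [mp [np ab]]]]; last first.
  by apply: eq_exist; exact: germ_set_eq ab.
have : germ_set a (Tagged elt b) by rewrite ab; exact: germ_set_refl.
by [].
Qed.

Lemma germ_step m n (mn : (m <= n)%N) (a : elt m) : germ (step mn a) = germ a.
Proof. by apply/germ_eq; exists n, (leqnn n), mn; rewrite step_comp. Qed.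

(** A limit inferior over the stages; a stage without representatives of [x] contributes the empty
    join, that is, bottom. *)
Definition germ_norm (x : germs) : V :=
  qsup (range (fun N =>
    qinf [set v | exists2 n, (N <= n)%N &
      v = qsup [set snorm (a : (s n : normed_set V)) | a in [set a : elt n | germ a = x]]])).

Definition germ_normed : SetMaps V := NormedSet germ_norm.

Definition germ_hom n : hom (s n) germ_normed := @germ n.

Lemma germ_hom_nat m n (mn : (m <= n)%N) :
  compm (@germ_hom n) (smap s mn) = @germ_hom m.
Proof. by apply/funext => a; exact: germ_step. Qed.

Definition germ_cocone : cocone s germ_normed := Cocone germ_hom_nat.

Lemma germ_colimit : is_colimit germ_cocone.
Proof.
move=> y sigma.
pose rep x := projT1 (cid (germP x)).
have repK x : germ (tagged (rep x)) = x by exact: projT2 (cid (germP x)).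
pose leg n : elt n -> (y : normed_set V) := sigma n.
have legE m n (mn : (m <= n)%N) a : leg n (step mn a) = leg m a.
  exact: (congr1 (fun h => h a) (leg_nat sigma mn)).
(* By [legE] the value does not depend on the representative chosen. *)
exists (fun x : germs => leg _ (tagged (rep x))); split.
  move=> n; apply/funext => a /=.
  have /germ_eq[p [mp [np E]]] := repK (germ a).
  by rewrite -(legE _ _ mp) E legE.
move=> f fP; apply/funext => x.
rewrite -[RHS](congr1 f (repK x)).
exact: (congr1 (fun h => h _) (esym (fP _))).
Qed.

End Germs.

(** * Norm estimates for the germ cocone *)

Lemma map_norm_le {d : Order.disp_t} {V : quantaleType d} (A B : normed_set V)
    (phi : A -> B) (v : V) :
  v <= map_norm phi <-> forall a, qmul v (snorm a) <= snorm (phi a).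
Proof.
split=> [vphi a|vphi].
  by rewrite qhom_adj; apply: le_trans vphi _; apply: qinf_lb; exists a.
by apply: qinf_ge => _ [a _ <-]; rewrite -qhom_adj.
Qed.

Theorem theorem3p4 (d : Order.disp_t) (V : quantaleType d) :
  cauchy_cocomplete (NormedSets V).
Proof.
move=> s s_cauchy; exists (germ_normed s), (germ_cocone s).
apply: normed_colimit_criterion; first exact: germ_colimit.
- apply: le_trans s_cauchy _; apply: qsup_le => _ [N _ <-].
  set c := qinf _.
  suff cN : c <= cocone_norm (X := NormedSets V) (germ_cocone s) N.
    by apply: le_trans cN _; apply: qsup_ub; exists N.
  apply: qinf_ge => _ [m Nm ->]; apply/map_norm_le => a.
  (* The term at [m] of the outer join is used: at every stage [n >= m] the germ of [a] is
     represented by [step mn a]. *)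
  apply: le_trans (qsup_ub (_ : range _ _)); last by exists m.
  apply: qinf_ge => _ [n mn ->].
  apply: le_trans (qsup_ub (_ : image _ _ _)); last first.
    by exists (step mn a); first exact: germ_step.
  apply: (iffLR (map_norm_le _ _)).
  by apply: qinf_lb; exists m, n, mn.
- move=> y f N; apply/map_norm_le => x.
  rewrite qmul_sup; apply: qsup_le => _ [_ [M _ <-] <-].
  (* The stage must be at least [N] for the bound on [f] after [germ] to apply, and at least [M] to
     occur in the meet of the norm of [x]. *)
  set n := maxn N M.
  apply: le_trans (qmul_monor _ (qinf_lb _)) _.
    by exists n; first exact: leq_maxr.
  rewrite qmul_sup; apply: qsup_le => _ [_ [a ax <-] <-].
  rewrite -ax; apply: (iffLR (map_norm_le (fun b : elt s n => f (germ b)) _)).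
  by apply: qinf_lb; exists n, (leq_maxl N M).
Qed.
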